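(* Let $2\le k<n$ and let $G$ be a unit tight equiangular $(k,n)$ frame with columns $f_1,\dots,f_n\in\mathbb{R}^k$, and put $\alpha=\sqrt{k(n-1)/(n-k)}$. If $\Lambda(G)=\mathrm{span}_{\mathbb{Z}}\{f_1,\dots,f_n\}$ is a lattice, i.e. a discrete additive subgroup of $\mathbb{R}^k$, then $\alpha$ is a rational number.
   Context: For $2\le k<n$, a real $k\times n$ matrix $G$ with columns $f_1,\dots,f_n$ is a unit tight equiangular $(k,n)$ frame if $GG'=\gamma I$ with $\gamma=n/k$, and $G'G=I+(1/\alpha)C$ with $\alpha=\sqrt{k(n-1)/(n-k)}$, where $C$ is an $n\times n$ matrix whose diagonal entries are $0$ and whose off-diagonal entries are all $\pm1$. Here $'$ denotes transpose. *)

(* Defs.v *)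
From HB Require Import structures.
From mathcomp Require Import all_boot all_order all_algebra.
From mathcomp Require Import boolp classical_sets reals topology normedtype.
Set Implicit Arguments.
Unset Strict Implicit.
Unset Printing Implicit Defensive.
Import Order.TTheory GRing.Theory Num.Theory.
Import numFieldNormedType.Exports.
Local Open Scope classical_set_scope.
Local Open Scope ring_scope.

Definition frame_alpha (R : realType) (k n : nat) : R :=
  Num.sqrt (k%:R * (n%:R - 1) / (n%:R - k%:R)).

Definition signature_matrix (R : realType) (n : nat) (C : 'M[R]_n) : Prop :=
  (forall i, C i i = 0) /\
  (forall i j, i != j -> C i j = 1 \/ C i j = - 1).

Definition unit_tight_equiangular (R : realType) (k n : nat)
    (G : 'M[R]_(k, n)) : Prop :=
  G *m G^T = (n%:R / k%:R)%:M /\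
  exists2 C : 'M[R]_n, signature_matrix C &
    G^T *m G = 1%:M + (frame_alpha R k n)^-1 *: C.

Definition column_int_span (R : realType) (k n : nat) (G : 'M[R]_(k, n)) :
    set 'cV[R]_k :=
  [set v | inIntSpan [tuple col j G | j < n] v].

(* Discreteness is that of the subspace topology: every point of L is isolated
   in L.  L need not span R^k. *)
Definition is_lattice (R : realType) (k : nat) (L : set 'cV[R]_k) : Prop :=
  zmod_closed (mem L) /\ L `<=` isolated L.

(* Main.v *)
Require Import Defs.
From mathcomp Require Import all_boot all_order all_algebra.
From mathcomp Require Import boolp classical_sets reals topology normedtype.
From mathcomp Require Import ring lra.
Import Order.TTheory GRing.Theory Num.Theory.
Import numFieldNormedType.Exports.
Local Open Scope ring_scope.

(** A nontrivial integer relation [\sum_i a_i f_i = 0], paired with an [f_j]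
    such that [a_j != 0], reads [a_j + s / alpha = 0] with [s] an integer, since
    the inner products of distinct columns are all [1 / alpha] or [- 1 / alpha];
    hence [alpha = - s / a_j]. Such a relation exists because [n > k]: let [x]
    be a nonzero real vector with [G x = 0]. By Dirichlet's simultaneous
    approximation theorem some positive multiple [m x] is as close as we like
    to an integer vector [p], which is nonzero when [x] is large, and
    [G p = G (p - m x)] is then a vector of the lattice close to [0], so it
    is [0] by discreteness. *)

Lemma truncn_eq_dist (R : archiRealDomainType) (a b : R) :
  0 <= a -> 0 <= b -> Num.truncn a = Num.truncn b -> `|a - b| < 1.
Proof.
move=> /truncn_itv /andP[a1 a2] /truncn_itv /andP[b1 b2] ab.
rewrite ab in a1 a2; rewrite -natr1 in a2 b2.
by rewrite ltr_norml; apply/andP; split; lra.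
Qed.

(** Pigeonhole: cut the unit cube into boxes of side [1 / N.+1 < d]. Two multiples of [x] have
    fractional parts in the same box, and their difference is the required multiple. *)
Lemma dirichlet_simultaneous (R : archiRealFieldType) (I : finType) (x : I -> R)
    (d : R) : 0 < d ->
  exists (m : nat) (p : I -> int),
    (0 < m)%N /\ forall i, `|(p i)%:~R - m%:R * x i| < d.
Proof.
move=> d0; pose N := Num.truncn d^-1.
pose y (m : nat) i := m%:R * x i - (Num.floor (m%:R * x i))%:~R.
have y_ge0 m i : 0 <= y m i by rewrite subr_ge0 floor_le.
have y_lt1 m i : y m i < 1.
  by have := floorD1_gt (m%:R * x i); rewrite intrD /y => ?; lra.
have N0 : 0 < N.+1%:R :> R by rewrite ltr0n.
have Nd : 1 < d * N.+1%:R.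
  by rewrite mulrC -ltr_pdivrMr // div1r truncnS_gt.
(* [c m] is the box containing [y m]; [m] takes one more value than there are boxes. As [y m i < 1],
   [inord] never falls back to its default. *)
pose c (m : 'I_(#|{ffun I -> 'I_N.+1}|.+1)) : {ffun I -> 'I_N.+1} :=
  [ffun i => inord (Num.truncn (N.+1%:R * y m i))].
have /injectivePn[m [m' mm' cE]] : ~~ injectiveb c.
  by apply/negP => /injectiveP/leq_card; rewrite card_ord ltnn.
have yE i : `|y m i - y m' i| < d.
  rewrite -(ltr_pM2r N0) (lt_trans _ Nd) // -[X in _ * X]gtr0_norm //.
  rewrite -normrM mulrC mulrBr; apply: truncn_eq_dist.
  - by rewrite mulr_ge0 // ltW.
  - by rewrite mulr_ge0 // ltW.
  - have lt (l : nat) : (Num.truncn (N.+1%:R * y l i) < N.+1)%N.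
      by rewrite truncn_lt_nat ?gtr_pMr // mulr_ge0 // ltW.
    by move/ffunP/(_ i): cE; rewrite !ffunE => /(congr1 val) /=; rewrite !inordK.
have {mm' cE} : (m : nat) != (m' : nat) by [].
move: (m : nat) (m' : nat) yE => {}m {}m'.
wlog lt_mm' : m m' / (m < m')%N => [H|] yE mm'.
  have [lt|lt|eq] := ltngtP m m'; first exact: H yE mm'.
  - by apply: (H m' m) => //; [move=> i; rewrite distrC | rewrite eq_sym].
  - by rewrite eq eqxx in mm'.
exists (m' - m)%N.
exists (fun i => Num.floor (m'%:R * x i) - Num.floor (m%:R * x i)).
split=> [|i]; first by rewrite subn_gt0.
have := yE i; rewrite natrB ?(ltnW lt_mm') // intrB /y.
by congr (`| _ | < _); ring.
Qed.

Lemma wide_kernel_col (F : fieldType) (k n : nat) (A : 'M[F]_(k, n)) :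
  (k < n)%N -> exists2 x : 'cV[F]_n, x != 0 & A *m x = 0.
Proof.
move=> kn; have kA : kermx A^T != 0.
  rewrite kermx_eq0 /row_free; apply/eqP => rA.
  by have := rank_leq_col A^T; rewrite rA leqNgt kn.
exists (nz_row (kermx A^T))^T; first by rewrite -trmx0 (inj_eq trmx_inj) nz_row_eq0.
by apply: trmx_inj; rewrite trmx_mul trmxK trmx0; apply/sub_kermxP/nz_row_sub.
Qed.

Lemma column_int_spanP (R : realType) (k n : nat) (G : 'M[R]_(k, n))
    (a : 'I_n -> int) : column_int_span G (G *m \col_j (a j)%:~R).
Proof.
exists [ffun j => a j]; apply/matrixP => i j.
rewrite mxE summxE; apply: eq_bigr => l _.
by rewrite nth_mktuple ffunE -scaler_int !mxE mulrC.
Qed.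

Lemma isolated0_int_relation (R : realType) (k n : nat) (G : 'M[R]_(k, n)) :
  (k < n)%N -> isolated (column_int_span G) 0 ->
  exists a : 'I_n -> int,
    (exists j, a j != 0) /\ G *m \col_j (a j)%:~R = 0.
Proof.
move=> kn [_ [V /nbhs_ballP[e /= e0 eV] VG]].
have [x0 x0_neq0 Gx0] := wide_kernel_col _ _ _ G kn.
have [j x0j] : exists j, x0 j 0 != 0.
  by have /cV0Pn[j] := x0_neq0; exists j.
(* With [x j 0 = 1], the multiple [m x] has [j]-th coordinate [m >= 1], so an integer within [1/2]
   of it is nonzero. *)
pose x := (x0 j 0)^-1 *: x0.
have Gx : G *m x = 0 by rewrite -scalemxAr Gx0 scaler0.
have xj : x j 0 = 1 by rewrite mxE mulVf.
(* The summand 1 makes [B] positive and strictly larger than the absolute sum of every row. *)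
pose B : R := 1 + \sum_i \sum_l `|G i l|.
have B0 : 0 < B by rewrite ltr_pwDl // !sumr_ge0 // => i _; rewrite sumr_ge0.
(* The bound [2^-1] forces [p j != 0]; [e / B] puts [G p] in the [e]-ball about 0, which is
   entrywise. *)
pose d := Num.min 2^-1 (e / B).
have d0 : 0 < d by rewrite lt_min invr_gt0 ltr0n divr_gt0.
have [m [p [m0 pm]]] := dirichlet_simultaneous _ _ (fun l => x l 0) d d0.
exists p; split.
  exists j; apply/eqP => pj.
  have := pm j; rewrite pj xj mulr1 sub0r normrN normr_nat lt_min => /andP[+ _].
  by have : 1 <= m%:R :> R; [rewrite ler1n | move=> ? ?; lra].
suff : (V `&` column_int_span G)%classic (G *m \col_l (p l)%:~R) by rewrite VG.
split; last exact: column_int_spanP.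
apply: eV; split=> // i l; rewrite mxE -ball_normE /= sub0r normrN.
have -> : G *m \col_l (p l)%:~R = G *m (\col_l (p l)%:~R - m%:R *: x).
  by rewrite mulmxBr -scalemxAr Gx scaler0 subr0.
rewrite (ord1 l) mxE; apply: le_lt_trans (ler_norm_sum _ _ _) _.
apply: (@le_lt_trans _ _ (\sum_l `|G i l| * d)).
  apply: ler_sum => h _; rewrite normrM ler_wpM2l // !mxE.
  by have := pm h; rewrite !mxE => /ltW.
rewrite -mulr_suml; apply: (@lt_le_trans _ _ (B * d)).
  rewrite ltr_pM2r // /B (bigD1 i) //= addrCA ltrDl ltr_pwDl //.
  by rewrite sumr_ge0 // => h _; rewrite sumr_ge0.
by rewrite mulrC -ler_pdivlMr // ge_min lexx orbT.
Qed.

Lemma rational_divz (R : realType) (a b : int) :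
  rational (a%:~R / b%:~R : R).
Proof. by exists (a%:~R / b%:~R) => //; rewrite fmorph_div /= !ratr_int. Qed.

Theorem proposition2p1 (R : realType) (k n : nat) (hk : (2 <= k)%N)
    (hkn : (k < n)%N) (G : 'M[R]_(k, n)) (hG : unit_tight_equiangular G)
    (hL : is_lattice (column_int_span G)) :
  rational (frame_alpha R k n).
Proof.
case: hG => _ [C [C0 C1] GG]; case: hL => [[L0 _] Liso].
have {L0} iso0 : isolated (column_int_span G) 0.
  by apply: Liso; rewrite inE in L0.
have [a [[j aj] Ga]] := isolated0_int_relation _ _ _ _ hkn iso0.
set alpha := frame_alpha R k n in GG *.
have [s sE] : exists s : int, (C *m \col_l (a l)%:~R) j 0 = s%:~R.
  apply/intrP; rewrite mxE; apply: rpred_sum => l _.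
  rewrite mxE rpredM ?intr_int //.
  have [<-|/C1[]->] := eqVneq j l; first by rewrite C0 rpred0.
  - exact: rpred1.
  - by rewrite rpredN1.
(* This is coordinate [j] of [G^T G a = 0]. *)
have rel : (a j)%:~R + alpha^-1 * s%:~R = 0.
  have := congr1 (fun v => (G^T *m v) j 0) Ga.
  rewrite mulmxA GG mulmx0 mulmxDl mul1mx -scalemxAl [RHS]mxE => <-.
  by rewrite -sE !mxE.
have aj0 : (a j)%:~R != 0 :> R by rewrite intr_eq0.
(* Since [0^-1 = 0], a vanishing [alpha] would turn [rel] into [a j = 0]. *)
have alpha0 : alpha != 0.
  by apply/eqP => a0; move: rel aj0; rewrite a0 invr0 mul0r addr0 => ->; rewrite eqxx.
suff -> : alpha = (- s)%:~R / (a j)%:~R by exact: rational_divz.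
apply: (mulIf aj0); rewrite divfK // intrN.
move/(congr1 (fun z => alpha * z)): rel; rewrite mulrDr mulr0 mulVKf // => /eqP.
by rewrite addr_eq0 => /eqP.
Qed.
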